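(* Let $q$ be an odd integer, $n=q^2+q+1$, and suppose $D\subseteq\mathbb{Z}_n$ is a difference set of size $q+1$ (so that a cyclic projective plane $\Pi_q$ exists). Let $J\subseteq\{1,\dots,\lfloor n/2\rfloor\}$ and let $1\le t\le q$. Suppose that the edges of the complete graph on vertex set $D$ whose lengths belong to $J$ form the union of $t$ pairwise edge-disjoint perfect matchings of this complete graph. Then \[tn\leq \alpha_1(C_n(J)).\]
   Context: A subset $D=\{d_0,\dots,d_q\}\subseteq\mathbb{Z}_n$ is a difference set if every nonzero $g\in\mathbb{Z}_n$ can be written uniquely as $g=d_i-d_j$ with $d_i\ne d_j$ in $D$; its translates $D+i$ ($i\in\mathbb{Z}_n$) are the lines of the cyclic projective plane on $\mathbb{Z}_n$. The length of a pair $\{x,y\}$ of distinct elements of $\mathbb{Z}_n$ is the unique $s\in\{1,\dots,\lfloor n/2\rfloor\}$ with $x-y\equiv\pm s\pmod n$. The circulant graph $C_n(J)$ has vertex set $\mathbb{Z}_n$, with $x,y$ adjacent iff the length of $\{x,y\}$ lies in $J$. A complete edge-coloring of a graph uses exactly $k$ colors such that for every pair of distinct colors there are two adjacent (sharing a vertex) edges receiving these colors; it is proper if adjacent edges receive distinct colors. The achromatic index $\alpha_1(G)$ is the largest $k$ such that $G$ has a proper complete edge-coloring with $k$ colors. *)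

(* Defs.v *)
From HB Require Import structures.
From mathcomp Require Import all_boot all_order all_algebra.
From mathcomp Require Import zify.

Set Implicit Arguments.
Unset Strict Implicit.
Unset Printing Implicit Defensive.

Import GRing.Theory.

Record sgraph := SGraph {
  vertex :> finType;
  adj : rel vertex;
  adj_sym : symmetric adj;
  adj_irr : irreflexive adj }.

Section Achromatic.
Variable G : sgraph.

Definition edges : {set {set G}} :=
  [set [set p.1; p.2] | p : G * G & adj p.1 p.2].

Definition edge := {e : {set G} | e \in edges}.

Definition adj_edges (e f : edge) : bool :=
  (e != f) && (val e :&: val f != set0).

Section Coloring.
Variables (k : nat) (c : {ffun edge -> 'I_k}).

Definition proper_coloring : bool :=
  [forall e, forall f, adj_edges e f ==> (c e != c f)].

(* The first conjunct says that exactly k colors are used. *)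
Definition complete_coloring : bool :=
  [forall i, exists e, c e == i] &&
  [forall i, forall j, (i != j) ==>
     [exists e, exists f, [&& adj_edges e f, c e == i & c f == j]]].

End Coloring.

Definition has_proper_complete_coloring (k : nat) : bool :=
  [exists c : {ffun edge -> 'I_k}, proper_coloring c && complete_coloring c].

(* All colors are used, so no more than #|edges| of them can occur
   (cf. [achromatic_index_max]) and the range of the maximum loses nothing.
   It is a maximum over a nonempty set: a proper coloring with as few colors
   as possible is complete. *)
Definition achromatic_index : nat :=
  \max_(k < #|edges|.+1 | has_proper_complete_coloring k) k.

Lemma achromatic_index_max k :
  has_proper_complete_coloring k -> k <= achromatic_index.
Proof.
move=> hk; have kE : k < #|edges|.+1.
  case/existsP: hk => c /and3P[_ /forallP/(_ _)/existsP surj _].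
  have cI : injective (fun i => xchoose (surj i)).
    move=> i j eij; rewrite -(eqP (xchooseP (surj i))) eij.
    exact: (eqP (xchooseP (surj j))).
  by have := leq_card _ cI; rewrite card_ord card_sig ltnS.
exact: (@leq_bigmax_cond _ _ _ (Ordinal kE) hk).
Qed.

End Achromatic.

Section Cyclic.
Variable n : nat.

Definition difference_set (D : {set 'Z_n}) : Prop :=
  forall g : 'Z_n, g != 0%R ->
  exists! p : 'Z_n * 'Z_n,
    [/\ p.1 \in D, p.2 \in D, p.1 != p.2 & g = (p.1 - p.2)%R].

(* Junk value 0 on sets that are not pairs; the specification on pairs is
   [pair_lengthP].  As usual, 'Z_n is the ring Z/nZ only when 1 < n. *)
Definition pair_length (e : {set 'Z_n}) : nat :=
  odflt ord0 [pick s : 'I_(n./2).+1 | (0 < s) &&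
    [exists x in e, exists y in e, (x != y) &&
      ((x - y == s%:R)%R || (x - y == - s%:R)%R)]].

Definition circulant_adj (J : {pred nat}) : rel 'Z_n :=
  fun x y => (x != y) && (pair_length [set x; y] \in J).

Lemma circulant_sym J : symmetric (circulant_adj J).
Proof. by move=> x y; rewrite /circulant_adj eq_sym setUC. Qed.

Lemma circulant_irr J : irreflexive (circulant_adj J).
Proof. by move=> x; rewrite /circulant_adj eqxx. Qed.

Definition circulant (J : {pred nat}) : sgraph :=
  SGraph (circulant_sym J) (circulant_irr J).

Lemma pair_lengthP (x y : 'Z_n) (s : nat) : 1 < n -> x != y ->
  pair_length [set x; y] = s <->
  0 < s <= n./2 /\ ((x - y = s%:R)%R \/ (x - y = - s%:R)%R).
Proof.
move=> n1 nxy.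
pose P s := (x - y == s%:R)%R || (x - y == - s%:R)%R.
have PE r : [exists a in [set x; y], exists b in [set x; y], (a != b) &&
      ((a - b == r%:R)%R || (a - b == - r%:R)%R)] = P r.
  apply/idP/idP.
    case/exists_inP=> a + /exists_inP[b +] /andP[].
    rewrite !inE => /orP[]/eqP-> /orP[]/eqP-> //; rewrite ?eqxx // => _.
    by rewrite -(opprB x y) eqr_oppLR eqr_opp orbC.
  move=> Pr; apply/exists_inP; exists x; first by rewrite !inE eqxx.
  by apply/exists_inP; exists y; rewrite ?nxy // !inE eqxx orbT.
have sub r : r <= n -> (- r%:R = (n - r)%:R :> 'Z_n)%R.
  move=> rn; rewrite natrB //; have -> : (n%:R = 0 :> 'Z_n)%R.
    by apply: val_inj; rewrite /= val_Zp_nat // modnn.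
  by rewrite sub0r.
have inj r r' : r < n -> r' < n -> (r%:R = r'%:R :> 'Z_n)%R -> r = r'.
  by move=> h h' /(congr1 val); rewrite /= !val_Zp_nat // !modn_small.
have uniqP r r' : 0 < r <= n./2 -> 0 < r' <= n./2 -> P r -> P r' -> r = r'.
  move=> h h' /orP[]/eqP e /orP[]/eqP; rewrite e ?sub; try lia;
    by move/inj => H; have := H ltac:(lia) ltac:(lia); lia.
have exP : exists2 r, 0 < r <= n./2 & P r.
  pose d := val (x - y)%R.
  have dn : d < n by rewrite /d -[X in _ < X]Zp_cast // ltn_ord.
  have dE : (x - y = d%:R)%R by rewrite /d natr_Zp.
  have d0 : 0 < d.
    by rewrite lt0n; apply: contra nxy => /eqP e; rewrite -subr_eq0 dE e.
  case: (leqP d n./2) => h.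
    by exists d; rewrite ?d0 // /P -dE eqxx.
  exists (n - d); first by lia.
  by rewrite /P -[X in _ || X]/(_ == _)%R -sub 1?ltnW // opprK -dE eqxx orbT.
rewrite /pair_length; split.
  case: pickP => [r /andP[r0] | no] /=.
    rewrite PE => Pr <-; split; first by rewrite r0 -ltnS ltn_ord.
    by case/orP: Pr => /eqP; [left | right].
  case: exP => r /andP[r0 rn] Pr.
  have rn' : r < (n./2).+1 by [].
  by have := no (Ordinal rn'); rewrite PE r0 Pr.
case=> hs xs; have Ps : P s by case: xs => /eqP e; rewrite /P e ?orbT.
case: pickP => [r /andP[r0] | no] /=.
  by rewrite PE => Pr; apply: uniqP => //; rewrite r0 -ltnS ltn_ord.
have rn' : s < (n./2).+1 by lia.
by have := no (Ordinal rn'); rewrite PE Ps /=; lia.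
Qed.

End Cyclic.

Section Matchings.
Variable T : finType.

Definition complete_edges (D : {set T}) : {set {set T}} :=
  [set e : {set T} | (e \subset D) && (#|e| == 2)].

Definition perfect_matching (D : {set T}) (M : {set {set T}}) : bool :=
  (M \subset complete_edges D) &&
  [forall x in D, #|[set e in M | x \in e]| == 1].

End Matchings.

(* Main.v *)
(* Translates of the matchings are the color classes: an edge {x, y} of the
   circulant graph lies on exactly one line D + a, and shifting it back by a
   lands in exactly one matching M i; it gets the color (i, a).  The class
   (i, a) is thus a matching covering every point of the line D + a.  As any
   two lines meet, two distinct classes cover a common point, where they have
   adjacent edges. *)
Require Import Defs.
From mathcomp Require Import all_boot all_order all_algebra.
From mathcomp Require Import zify.

Set Implicit Arguments.
Unset Strict Implicit.
Unset Printing Implicit Defensive.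

Import GRing.Theory.

(** Numbering the colors by [enum_rank] lets any finite type serve as palette, here the pairs of a
    matching index and a translation. *)
Lemma leq_achromatic_index (G : sgraph) (K : finType) (c : edge G -> K) :
  (forall e f, adj_edges e f -> c e != c f) ->
  (forall i, exists e, c e = i) ->
  (forall i j, i != j -> exists e f, [/\ adj_edges e f, c e = i & c f = j]) ->
  #|K| <= achromatic_index G.
Proof.
move=> c_proper c_onto c_complete; apply: achromatic_index_max.
apply/existsP; exists [ffun e => enum_rank (c e)].
apply/and3P; split.
- apply/forallP=> e; apply/forallP=> f; apply/implyP=> /c_proper.
  by rewrite !ffunE (inj_eq enum_rank_inj).
- apply/forallP=> i; have [e ce] := c_onto (enum_val i).
  by apply/existsP; exists e; rewrite ffunE ce enum_valK.
- apply/forallP=> i; apply/forallP=> j; apply/implyP=> ij.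
  have [|e [f [aef ce cf]]] := c_complete (enum_val i) (enum_val j).
    by rewrite (inj_eq enum_val_inj).
  apply/existsP; exists e; apply/existsP; exists f.
  by rewrite aef !ffunE ce cf !enum_valK !eqxx.
Qed.

Section Translation.
Variable V : finZmodType.
Implicit Types (A : {set V}) (a x y : V).

Definition translate a A : {set V} := [set (x + a)%R | x in A].

Lemma mem_translate a A x : (x \in translate a A) = ((x - a)%R \in A).
Proof.
apply/imsetP/idP => [[y yA ->]|xA]; first by rewrite addrK.
by exists (x - a)%R => //; rewrite subrK.
Qed.

Lemma translateK a : cancel (translate a) (translate (- a)%R).
Proof. by move=> A; apply/setP=> x; rewrite !mem_translate opprK addrK. Qed.

Lemma translateNK a : cancel (translate (- a)%R) (translate a).
Proof. by move=> A; apply/setP=> x; rewrite !mem_translate opprK subrK. Qed.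

Lemma translate_set2 a x y :
  translate a [set x; y] = [set (x + a)%R; (y + a)%R].
Proof. by rewrite /translate imsetU1 imset_set1. Qed.

End Translation.

Section CirculantGraph.
Variables (n : nat) (J : {pred nat}).
Hypothesis n_gt1 : 1 < n.

(** The length depends only on the difference of the two points. [pair_lengthP] is applied in both
    directions, with the length of [[set x; y]] as [s]. *)
Lemma pair_length_translate (a x y : 'Z_n) : x != y ->
  pair_length [set (x + a)%R; (y + a)%R] = pair_length [set x; y].
Proof.
move=> xy; have xya : (x + a != y + a)%R by rewrite (inj_eq (addIr a)).
have diffE : (x + a - (y + a) = x - y)%R by rewrite (addrC y) addrKA.
apply/(pair_lengthP _ n_gt1 xya); rewrite diffE.
exact/(pair_lengthP _ n_gt1 xy).
Qed.

Lemma circulant_edgeP (e : {set 'Z_n}) :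
  reflect (exists x y, [/\ e = [set x; y], x != y & pair_length e \in J])
          (e \in edges (circulant n J)).
Proof.
apply: (iffP imsetP) => [[[x y]]|[x [y [-> xy eJ]]]].
  by rewrite inE => /andP[/= xy eJ] ->; exists x, y.
by exists (x, y); rewrite // inE /= /circulant_adj xy.
Qed.

Lemma translate_circulant_edge a (e : {set 'Z_n}) :
  e \in edges (circulant n J) -> translate a e \in edges (circulant n J).
Proof.
case/circulant_edgeP=> x [y [-> xy eJ]]; apply/circulant_edgeP.
exists (x + a)%R, (y + a)%R; rewrite translate_set2 pair_length_translate //.
by rewrite (inj_eq (addIr a)).
Qed.

End CirculantGraph.

Section PerfectMatching.
Variables (T : finType) (D : {set T}) (M : {set {set T}}).
Hypothesis MD : perfect_matching D M.

Lemma matching_sub e : e \in M -> e \subset D.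
Proof.
by case/andP: MD => /subsetP sMD _ /sMD; rewrite inE => /andP[].
Qed.

Lemma matching_edge x : x \in D -> exists2 e, e \in M & x \in e.
Proof.
case/andP: MD => _ /forall_inP covM /covM /cards1P[e eE].
by exists e; have := set11 e; rewrite -eE inE => /andP[].
Qed.

Lemma matching_uniq x e f :
  e \in M -> f \in M -> x \in e -> x \in f -> e = f.
Proof.
move=> eM fM xe xf; have xD := subsetP (matching_sub eM) x xe.
case/andP: MD => _ /forall_inP /(_ x xD) /cards1P[g gE].
have /set1P-> : e \in [set g] by rewrite -gE inE eM.
by have /set1P-> : f \in [set g] by rewrite -gE inE fM.
Qed.

End PerfectMatching.

Section TranslatedMatchings.
Variables (n t : nat) (D : {set 'Z_n}) (J : {pred nat}).
Variable M : 'I_t -> {set {set 'Z_n}}.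
Hypothesis n_gt1 : 1 < n.
Hypothesis D_diff : difference_set D.
Hypothesis D_neq0 : D != set0.
Hypothesis M_perfect : forall i, perfect_matching D (M i).
Hypothesis M_disjoint : forall i j, i != j -> [disjoint M i & M j].
Hypothesis M_cover :
  [set e in complete_edges D | pair_length e \in J] = \bigcup_(i < t) M i.

Lemma matching_circulant_edge i e :
  e \in M i -> e \in edges (circulant n J).
Proof.
move=> eM; have : e \in \bigcup_(i < t) M i by apply/bigcupP; exists i.
rewrite -M_cover !inE => /andP[/andP[_ /cards2P[x [y [xy eE]]]] eJ].
by apply/circulant_edgeP; exists x, y.
Qed.

(** The uniqueness half of the difference property; geometrically, two distinct points lie on at
    most one line. *)
Lemma difference_uniq u v u' v' :
  u \in D -> v \in D -> u' \in D -> v' \in D -> u != v ->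
  (u - v = u' - v')%R -> u = u'.
Proof.
move=> uD vD u'D v'D uv dE; have d0 : (u - v != 0)%R by rewrite subr_eq0.
have uv' : u' != v' by rewrite -subr_eq0 -dE.
have [p [_ p_uniq]] := D_diff d0.
have e1 : p = (u, v) by apply: p_uniq.
have e2 : p = (u', v') by apply: p_uniq.
by move: e2; rewrite e1 => -[].
Qed.

(** For distinct [a] and [b], write [a - b = u - v] with [u], [v] in [D]; then [v + a = u + b] lies
    on both lines. *)
Lemma lines_meet a b : exists x, (x - a)%R \in D /\ (x - b)%R \in D.
Proof.
have [->|ab] := eqVneq a b.
  by case/set0Pn: D_neq0 => d dD; exists (d + b)%R; rewrite addrK.
have ab0 : (a - b != 0)%R by rewrite subr_eq0.
have [[u v] [[/= uD vD _ abE] _]] := D_diff ab0.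
exists (v + a)%R; rewrite addrK; split=> //.
by rewrite -addrA abE addrC subrK.
Qed.

(** The coloring is first a relation; it becomes a function once each circulant edge is known to
    have exactly one color. *)
Definition has_color (e : {set 'Z_n}) (p : 'I_t * 'Z_n) : bool :=
  translate (- p.2)%R e \in M p.1.

Lemma has_color_ex e :
  e \in edges (circulant n J) -> exists p, has_color e p.
Proof.
move=> eE; have /circulant_edgeP[x [y [eq_e xy eJ]]] := eE.
have xy0 : (x - y != 0)%R by rewrite subr_eq0.
have [[u v] [[/= uD vD uv xyE] _]] := D_diff xy0.
(* Since [x - y = u - v], also [a = y - v]: the line [D + a] contains both points, and shifting back
   by [a] gives [[set u; v]], of the same length. *)
pose a := (x - u)%R.
have xa : (x - a = u)%R by rewrite /a subKr.
have ya : (y - a = v)%R by rewrite /a opprB addrCA -opprB xyE opprB subrKC.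
have : translate (- a)%R e \in \bigcup_(i < t) M i.
  rewrite -M_cover !inE eq_e translate_set2 pair_length_translate // -eq_e eJ.
  by rewrite xa ya subUset !sub1set uD vD cards2 uv.
by case/bigcupP=> i _ eM; exists (i, a).
Qed.

(** The two endpoints determine the line, hence the translation; disjointness of the matchings then
    determines the index. *)
Lemma has_color_uniq e p p' : e \in edges (circulant n J) ->
  has_color e p -> has_color e p' -> p = p'.
Proof.
case: p p' => [i a] [j b]; rewrite /has_color /=.
case/circulant_edgeP=> x [y [-> xy _]] eMi eMj.
have inD k c : translate (- c)%R [set x; y] \in M k ->
    (x - c)%R \in D /\ (y - c)%R \in D.
  move/(matching_sub (M_perfect k)).
  by rewrite translate_set2 subUset !sub1set => /andP[].
have [xaD yaD] := inD _ _ eMi; have [xbD ybD] := inD _ _ eMj.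
have ab : a = b.
  (* It suffices that [x - a = x - b]: both shifted pairs lie in [D] and have difference [x - y]. *)
  apply/oppr_inj/(addrI x)/(difference_uniq xaD yaD xbD ybD).
    by rewrite (inj_eq (addIr _)).
  by rewrite !(addrC y) !addrKA.
rewrite -{}ab in eMj *; congr (_, _); apply/eqP.
apply: contraTT eMi => /M_disjoint; rewrite disjoint_sym => /disjointFr.
by move/(_ _ eMj) ->.
Qed.

(** As [M i] is perfect, one of its edges covers [x - a]; its translate by [a] passes through
    [x]. *)
Lemma has_color_edge x i a : (x - a)%R \in D ->
  exists e : edge (circulant n J), x \in val e /\ has_color (val e) (i, a).
Proof.
case/(matching_edge (M_perfect i)) => m mM xm.
have eE := translate_circulant_edge n_gt1 a (matching_circulant_edge mM).
by exists (Sub (translate a m) eE); rewrite /has_color /= mem_translate translateK.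
Qed.

(** Two edges of color [p] sharing [x] shift back to edges of one matching sharing [x - p.2], so
    they coincide. *)
Lemma has_color_proper (e f : edge (circulant n J)) p :
  adj_edges e f -> has_color (val e) p -> ~~ has_color (val f) p.
Proof.
case/andP=> ef /set0Pn[x /setIP[xe xf]] eM; apply: contra ef => fM.
apply/eqP/val_inj/(can_inj (translateNK p.2)).
by apply: (matching_uniq (M_perfect p.1) eM fM (x := (x - p.2)%R));
  rewrite mem_translate opprK subrK.
Qed.

Lemma translated_matchings_achromatic :
  t * n <= achromatic_index (circulant n J).
Proof.
have c_ex (e : edge (circulant n J)) := has_color_ex (valP e).
pose c e := xchoose (c_ex e).
have cP e : has_color (val e) (c e) by apply: xchooseP.
have cE e p : has_color (val e) p -> c e = p.
  by move=> ep; apply: has_color_uniq (valP e) (cP e) ep.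
have -> : t * n = #|{: 'I_t * 'Z_n}|.
  by rewrite card_prod !card_ord Zp_cast.
apply: (leq_achromatic_index (c := c)).
- move=> e f aef; apply: contraTneq (cP f) => <-.
  exact: has_color_proper aef (cP e).
(* Meeting a line with itself merely yields a point on it. *)
- case=> i a; have [x [xa _]] := lines_meet a a.
  by have [e [_ /cE]] := has_color_edge i xa; exists e.
- case=> i a [j b] ij; have [x [xa xb]] := lines_meet a b.
  have [e [xe /cE ce]] := has_color_edge i xa.
  have [f [xf /cE cf]] := has_color_edge j xb.
  exists e, f; split=> //; apply/andP; split.
    by apply: contraNneq ij => ef; rewrite -ce -cf ef.
  by apply/set0Pn; exists x; rewrite inE xe.
Qed.

End TranslatedMatchings.

Theorem theorem9 (q n t : nat) (D : {set 'Z_n}) (J : {pred nat})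
  (hq : odd q) (hn : n = q ^ 2 + q + 1)
  (hD : difference_set D) (cardD : #|D| = q + 1)
  (hJ : forall s : nat, s \in J -> 1 <= s <= n./2)
  (ht : 1 <= t <= q)
  (hM : exists M : 'I_t -> {set {set 'Z_n}},
      [/\ forall i : 'I_t, perfect_matching D (M i),
          forall i j : 'I_t, i != j -> [disjoint M i & M j]
        & [set e in complete_edges D | pair_length e \in J] =
          \bigcup_(i < t) M i]) :
  t * n <= achromatic_index (circulant n J).
Proof.
case: hM => M [M_perfect M_disjoint M_cover].
(* Oddness excludes [q = 0], for which [n] would be 1. *)
have n_gt1 : 1 < n by rewrite hn; case: q hq {hn cardD ht}; lia.
have D_neq0 : D != set0 by rewrite -card_gt0 cardD addn1.
exact: translated_matchings_achromatic M_cover.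
Qed.
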